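(* Let $n,\delta\in\mathbb{N}$ with $\delta\geq 3$ and $n\geq 16$. If $G$ is a connected $C_4$-free graph of order $n$, minimum degree $\delta$ and radius $r$, then \[\pi(G)\geq \frac{\delta^2-2\lfloor\frac{\delta}{2}\rfloor+1}{5(n-1)}\left(r^2-8r+\frac{127}{8}\right).\]
   Context: All graphs are finite and simple. For a connected graph $G$ of order $n\ge 2$ and a vertex $v$, $\overline{\sigma}(v)=\frac{1}{n-1}\sum_{w\in V(G)}d(v,w)$, where $d$ is the shortest-path distance, and the proximity is $\pi(G)=\min_{v\in V(G)}\overline{\sigma}(v)$. The radius is the minimum eccentricity. A graph is $C_4$-free if it does not contain a $4$-cycle as a (not necessarily induced) subgraph. *)

(* Defs.v *)
From mathcomp Require Import all_boot all_order all_algebra.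

Set Implicit Arguments.
Unset Strict Implicit.
Unset Printing Implicit Defensive.

Import Order.TTheory GRing.Theory Num.Theory.
Local Open Scope ring_scope.

Definition simple_graph (T : finType) (e : rel T) : Prop :=
  symmetric e /\ irreflexive e.

Definition connected_graph (T : finType) (e : rel T) : Prop :=
  forall x y : T, connect e x y.

Definition C4_free (T : finType) (e : rel T) : Prop :=
  forall c : seq T, size c = 4%N -> ~ ucycle e c.

Definition has_path (T : finType) (e : rel T) (x y : T) (k : nat) : bool :=
  [exists p : k.-tuple T, [&& path e x p, last x p == y & uniq (x :: p)]].

(* A path has fewer than #|T| edges, so the range of k loses nothing; the     *)
(* value is #|T| when there is no path from x to y.                           *)
Definition dist (T : finType) (e : rel T) (x y : T) : nat :=
  \big[minn/#|T|]_(k < #|T| | has_path e x y k) k.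

Definition degree (T : finType) (e : rel T) (v : T) : nat :=
  #|[set w | e v w]|.

(* In each of the minima below the initial value #|T| is an upper bound of    *)
(* all the terms, so that it is the true minimum whenever T is nonempty.      *)
Definition min_degree (T : finType) (e : rel T) : nat :=
  \big[minn/#|T|]_(v : T) degree e v.

Definition eccentricity (T : finType) (e : rel T) (v : T) : nat :=
  (\max_(w : T) dist e v w)%N.

Definition radius (T : finType) (e : rel T) : nat :=
  \big[minn/#|T|]_(v : T) eccentricity e v.

Definition avg_dist (T : finType) (e : rel T) (v : T) : rat :=
  (#|T|%:R - 1)^-1 * \sum_(w : T) (dist e v w)%:R.

Definition proximity (T : finType) (e : rel T) : rat :=
  \big[Num.min/#|T|%:R]_(v : T) avg_dist e v.

(* Main.v *)
Require Import Defs.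
From mathcomp Require Import all_boot all_order all_algebra.
From mathcomp Require Import zify lra.

Set Implicit Arguments.
Unset Strict Implicit.
Unset Printing Implicit Defensive.

Import Order.TTheory GRing.Theory Num.Theory.

(** In a C4-free graph every ball of radius 2 has at least
    K = delta^2 - 2 floor(delta/2) + 1 vertices, so a family of centres at
    pairwise distance at least 5 gives sum_w d(v,w) >= K sum_c (d(v,c) - 2).
    Spacing centres by 5 along one geodesic from v of length R >= r contributes
    only about K R^2/10. A second branch doubles this: let y_j be the vertex at
    level j = R - r + 9 of the first geodesic and x a vertex with d(y_j,x) >= r.
    Then x has level L = r - j + s for some s >= 0, and a vertex of level b on a
    geodesic from v to x with 2b >= s + 9 is at distance at least 5 from the
    whole first geodesic, since a shorter connection would bring x closer than r
    to y_j. When 2r < R + 11 or r <= 14, one branch is enough. *)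

(** * Distances and geodesics *)

Lemma dist_le_path (T : finType) (e : rel T) (x : T) (p : seq T) :
  path e x p -> dist e x (last x p) <= size p.
Proof.
(* [dist] ranges over simple paths only, so the walk is first shortened to one. *)
case/shortenP => q pq uq sub_qp.
have szq : size q < #|T|.
  by rewrite -[(size q).+1]/(size (x :: q)) -(card_uniqP uq) max_card.
have [_ uq'] := andP uq.
apply: leq_trans (uniq_leq_size uq' sub_qp).
rewrite /dist -minEnat -leEnat.
apply: (@bigmin_le_cond _ nat _ _ (Ordinal szq)).
by apply/existsP; exists (in_tuple q); rewrite pq eqxx.
Qed.

Lemma dist_path (T : finType) (e : rel T) (x y : T) :
  connected_graph e ->
  exists p : seq T, [/\ path e x p, last x p = y & size p = dist e x y].
Proof.
move=> con; have /connectP[p0 pp0 ->] := con x y.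
case/shortenP: pp0 => q pq uq _.
have szq : size q < #|T|.
  by rewrite -[(size q).+1]/(size (x :: q)) -(card_uniqP uq) max_card.
have Pq : has_path e x (last x q) (Ordinal szq).
  by apply/existsP; exists (in_tuple q); rewrite pq eqxx.
(* Every admissible length is below the default [#|T|], so the minimum is attained by an actual
   path. *)
have le_T (k : 'I_#|T|) :
  has_path e x (last x q) k -> (nat_of_ord k <= #|T| :> nat)%O.
  by move=> _; rewrite leEnat ltnW.
have [k /existsP[p /and3P[pp /eqP lp _]] Ek] := 
  @eq_bigmin _ nat _ _ _ (fun k : 'I_#|T| => has_path e x (last x q) k) _ Pq le_T.
by exists p; rewrite size_tuple /dist -minEnat Ek.
Qed.

Lemma dist_triangle (T : finType) (e : rel T) (x y z : T) :
  connected_graph e -> dist e x z <= dist e x y + dist e y z.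
Proof.
move=> con; have [p [pp <- <-]] := dist_path x y con.
have [q [pq <- <-]] := dist_path (last x p) z con.
by rewrite -size_cat -last_cat; apply: dist_le_path; rewrite cat_path pp.
Qed.

Lemma dist_sym (T : finType) (e : rel T) (x y : T) :
  symmetric e -> connected_graph e -> dist e x y = dist e y x.
Proof.
move=> sym con.
have le a b : dist e a b <= dist e b a.
  have [p [pp <- <-]] := dist_path b a con.
  have /= := @dist_le_path _ e (last b p) (rev (belast b p)).
  rewrite size_rev size_belast rev_path.
  have -> : last (last b p) (rev (belast b p)) = b.
    by case: p {pp} => //= c p; rewrite rev_cons last_rcons.
  apply; rewrite (eq_path (e' := e)) // => c d; exact: sym.
by apply/eqP; rewrite eqn_leq !le.
Qed.

Lemma distxx (T : finType) (e : rel T) (x : T) : dist e x x = 0.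
Proof. by apply/eqP; rewrite -leqn0 (@dist_le_path _ e x [::]). Qed.

Lemma dist_edge (T : finType) (e : rel T) (x y : T) : e x y -> dist e x y <= 1.
Proof. by move=> exy; rewrite (@dist_le_path _ e x [:: y]) //= exy. Qed.

Lemma dist_gt0 (T : finType) (e : rel T) (x y : T) :
  connected_graph e -> x != y -> 0 < dist e x y.
Proof.
move=> con; have [p [_ <- <-]] := dist_path x y con.
by case: p => //; rewrite eqxx.
Qed.

Lemma dist1_edge (T : finType) (e : rel T) (x y : T) :
  connected_graph e -> dist e x y = 1 -> e x y.
Proof.
move=> con; have [p [pp <- <-]] := dist_path x y con.
by case: p pp => [|a [|b p]] //= /andP[].
Qed.

Lemma dist_leq_card (T : finType) (e : rel T) (x y : T) : dist e x y <= #|T|.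
Proof. by rewrite /dist -minEnat -leEnat; apply: bigmin_le_id. Qed.

(** Prefixes of a shortest path give the upper bounds; the three pieces cut at levels [a] and [b]
    must add up to [dist e x y], so none can be shorter. *)
Lemma geodesic (T : finType) (e : rel T) (x y : T) :
  symmetric e -> connected_graph e ->
  exists f : nat -> T, [/\ f 0 = x, f (dist e x y) = y &
    forall a b, a <= b <= dist e x y -> dist e (f a) (f b) = b - a].
Proof.
move=> sym con; have [p [pp lp sp]] := dist_path x y con.
exists (fun i => last x (take i p)); split.
- by rewrite take0.
- by rewrite -sp take_size.
have le a b : a <= b <= dist e x y ->
    dist e (last x (take a p)) (last x (take b p)) <= b - a.
  case/andP=> ab bR.
  have Eb : take b p = take a p ++ take (b - a) (drop a p).
    by rewrite -takeD subnKC.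
  rewrite Eb last_cat; apply: leq_trans (dist_le_path _) _.
    have : path e x (take b p ++ drop b p) by rewrite cat_take_drop.
    by rewrite Eb !cat_path => /andP[/andP[]].
  by rewrite size_take_min geq_minl.
move=> a b /andP[ab bR]; apply/eqP; rewrite eqn_leq le ?ab //=.
have h1 := le 0 a; have h2 := le b (dist e x y).
rewrite /= take0 /= in h1; rewrite -sp take_size lp sp in h2.
have := dist_triangle x (last x (take a p)) y con.
have := dist_triangle (last x (take a p)) (last x (take b p)) y con.
lia.
Qed.

(** * Degrees, eccentricities and the radius *)

Lemma degree_ge (T : finType) (e : rel T) (v : T) : min_degree e <= degree e v.
Proof. by rewrite /min_degree -minEnat -leEnat; apply: bigmin_le. Qed.

Lemma radius_le (T : finType) (e : rel T) (v : T) : radius e <= eccentricity e v.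
Proof. by rewrite /radius -minEnat -leEnat; apply: bigmin_le. Qed.

Lemma leq_radius (T : finType) (e : rel T) (k : nat) :
  k <= #|T| -> (forall v, k <= eccentricity e v) -> k <= radius e.
Proof.
move=> kT kecc; rewrite /radius -minEnat -leEnat.
by apply/bigmin_geP; split=> // v _; apply: kecc.
Qed.

Lemma dist_le_ecc (T : finType) (e : rel T) (v w : T) :
  dist e v w <= eccentricity e v.
Proof. exact: leq_bigmax. Qed.

Lemma ecc_attained (T : finType) (e : rel T) (v : T) :
  exists w, dist e v w = eccentricity e v.
Proof.
have cT : 0 < #|T| by apply/card_gt0P; exists v.
by rewrite /eccentricity; have [w ->] := bigop.eq_bigmax (dist e v) cT; exists w.
Qed.

(** * Size of balls of radius 2 *)

Lemma sum_sym_rel_even (T : finType) (g : rel T) :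
  symmetric g -> irreflexive g -> ~~ odd (\sum_x \sum_y g x y).
Proof.
move=> sym irr.
(* Ordering the vertices splits the ordered pairs into two classes exchanged by symmetry. *)
pose lt (x y : T) := enum_rank x < enum_rank y.
have E : \sum_x \sum_y g x y = \sum_x \sum_y (g x y && lt x y) +
    \sum_x \sum_y (g x y && lt y x).
  rewrite -big_split; apply: eq_bigr => x _; rewrite -big_split.
  apply: eq_bigr => y _ /=; rewrite /lt.
  have [->|/eqP ne] := eqVneq x y; first by rewrite irr.
  have : nat_of_ord (enum_rank x) != enum_rank y.
    by apply/eqP => /ord_inj/enum_rank_inj.
  by case: ltngtP => //; case: (g x y).
rewrite E [X in _ + X]exchange_big /=.
under [X in _ + X]eq_bigr => x _ do under eq_bigr => y _ do rewrite sym.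
by rewrite addnn odd_double.
Qed.

Lemma C4_free_common_neighbors (T : finType) (e : rel T) (v w : T) :
  simple_graph e -> C4_free e -> v != w ->
  \sum_(u | e v u) e u w <= 1.
Proof.
move=> [sym irr] C4 vw.
have -> : \sum_(u | e v u) e u w = #|[set u | e v u && e u w]|.
  rewrite -sum1_card big_mkcond [RHS]big_mkcond; apply: eq_bigr => u _.
  by rewrite inE; case: (e v u); case: (e u w).
rewrite leqNgt; apply/negP => /card_gt1P[a [b []]].
rewrite !inE => /andP[va aw] /andP[vb bw] ab.
have ne x y : e x y -> x != y by apply: contraTneq => ->; rewrite irr.
apply: (C4 [:: v; a; w; b]) => //.
rewrite /ucycle /= !inE va aw (sym w b) bw (sym b v) vb /=.
by rewrite !negb_or vw ab (ne v a) ?(ne a w) ?(ne v b) // eq_sym (ne b w).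
Qed.

(* For w outside the closed neighbourhood of v the inner sum counts common    *)
(* neighbours of v and w; among the neighbours of v, edges form a matching,   *)
(* whose number of endpoints is even.                                         *)
Lemma C4_free_ball2 (T : finType) (e : rel T) (v : T) :
  simple_graph e -> connected_graph e -> C4_free e ->
  (degree e v * min_degree e).+1 <=
  #|[set w | dist e v w <= 2]| + 2 * (degree e v %/ 2).
Proof.
move=> [sym irr] con C4.
set d := degree e v; set delta := min_degree e.
pose A (w : T) := (w != v) && ~~ e v w.
have Ed : d = \sum_(u | e v u) 1 by rewrite /d /degree -sum1dep_card.
have ball : 1 + d + \sum_w A w * \sum_(u | e v u) e u w <=
    #|[set w | dist e v w <= 2]|.
  have -> : 1 + d = \sum_w ((w == v) + e v w).
    rewrite big_split Ed [\sum_(u | _) 1]big_mkcond /=; congr (_ + _).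
    by rewrite (bigD1 v) //= eqxx big1 // => i /negbTE ->.
  rewrite -big_split -sum1_card.
  rewrite [leqRHS]big_mkcond; apply: leq_sum => w _ /=.
  rewrite /A inE; have [->|wv] := eqVneq w v.
    by rewrite irr distxx /=.
  have [evw|nvw] := boolP (e v w).
    by rewrite (leq_trans (dist_edge evw)).
  rewrite /= add0n mul1n; case: (leqP (dist e v w) 2) => [_|far].
    by apply: C4_free_common_neighbors => //; rewrite eq_sym.
  rewrite big1 // => u evu; apply/eqP; rewrite eqb0; apply/negP => euw.
  have := dist_triangle v u w con; have := dist_edge evu; have := dist_edge euw.
  lia.
pose g := [rel x y | [&& e v x, e v y & e x y]].
have even_g : ~~ odd (\sum_u \sum_w g u w).
  apply: sum_sym_rel_even => [x y|x] /=; last by rewrite irr !andbF.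
  by rewrite (sym x y) andbCA.
have Eg : \sum_u \sum_w g u w = \sum_(u | e v u) \sum_w (e v w && e u w).
  rewrite [RHS]big_mkcond; apply: eq_bigr => u _ /=.
  by case: (e v u) => //; rewrite big1.
have le_g : \sum_u \sum_w g u w <= d.
  rewrite Eg Ed; apply: leq_sum => u evu.
  have vu : v != u by apply: contraTneq evu => <-; rewrite irr.
  have vuC := C4_free_common_neighbors (conj sym irr) C4 vu.
  apply: leq_trans vuC; rewrite [leqRHS]big_mkcond; apply: leq_sum => w _ /=.
  by rewrite (sym w u); case: (e v w).
have le2 : \sum_u \sum_w g u w <= 2 * (d %/ 2) by lia.
(* Each neighbour [u] of [v] has at least [delta] neighbours, sorted here into [v] itself,
   neighbours of [v], and the rest. *)
have deg_split : d * delta <= \sum_w A w * (\sum_(u | e v u) e u w) + d +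
    \sum_u \sum_w g u w.
  have -> : \sum_w A w * (\sum_(u | e v u) e u w) =
      \sum_(u | e v u) \sum_w A w * e u w.
    by rewrite exchange_big; apply: eq_bigr => w _; rewrite big_distrr.
  rewrite Eg Ed big_distrl -!big_split /=; apply: leq_sum => u evu.
  rewrite mul1n; apply: leq_trans (degree_ge e u) _.
  have -> : 1 = \sum_w (w == v) by rewrite (bigD1 v) //= eqxx big1 // => i /negbTE ->.
  rewrite -!big_split /degree -sum1dep_card [leqLHS]big_mkcond /=.
  apply: leq_sum => w _; rewrite /A.
  by case: (w == v); case: (e v w); case: (e u w).
lia.
Qed.

(** * Packing balls along geodesics *)

Lemma packing_bound (T I : finType) (e : rel T) (v : T) (K : nat) (c : I -> T) :
  symmetric e -> connected_graph e ->
  (forall u, K <= #|[set w | dist e u w <= 2]|) ->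
  (forall i j, i != j -> 4 < dist e (c i) (c j)) ->
  K * \sum_i (dist e v (c i) - 2) <= \sum_w dist e v w.
Proof.
move=> sym con ballK sep.
(* The balls of radius 2 around the centres are disjoint. *)
have hit w : \sum_i (dist e (c i) w <= 2) <= 1.
  have [i hi|none] := pickP (fun i => dist e (c i) w <= 2); last first.
    by rewrite big1 // => i _; rewrite none.
  rewrite (bigD1 i) //= hi big1 // => j ji; apply/eqP; rewrite eqb0.
  have := sep _ _ ji; have := dist_triangle (c j) w (c i) con.
  rewrite (dist_sym w) //; lia.
apply: (@leq_trans (\sum_w \sum_i (dist e (c i) w <= 2) * dist e v w)).
  rewrite exchange_big big_distrr; apply: leq_sum => i _ /=.
  apply: leq_trans (_ : #|[set w | dist e (c i) w <= 2]| *
    (dist e v (c i) - 2) <= _); first by rewrite leq_mul2r ballK orbT.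
  rewrite -sum1dep_card big_distrl [leqLHS]big_mkcond; apply: leq_sum => w _ /=.
  case: (leqP (dist e (c i) w) 2) => // near; have := dist_triangle v w (c i) con.
  rewrite (dist_sym w) //; lia.
apply: leq_sum => w _; rewrite -big_distrl /=.
by rewrite -{2}[dist e v w]mul1n leq_mul2r hit orbT.
Qed.

(** The hypothesis keeps even the last term [a - 5 * (p - 1)] from being truncated, so this is an
    arithmetic series. *)
Lemma sum_step5 (p a : nat) : 5 * p <= a + 5 ->
  2 * \sum_(i < p) (a - 5 * i) = p * (2 * a + 5 - 5 * p).
Proof.
elim: p => [|p IH] hp; first by rewrite big_ord0.
rewrite big_ord_recr /= mulnDr IH; last lia.
have [k ->] : exists k, a = 5 * p + k by exists (a - 5 * p); lia.
nia.
Qed.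

(** Centres sit at levels R, R - 5, ... of [f] and L, L - 5, ... of [g]. The last two hypotheses
    keep the lowest ones at level at least 2 and at least [h] respectively. *)
Lemma two_branch_bound (T : finType) (e : rel T) (v : T) (K R L h p q : nat)
    (f g : nat -> T) :
  symmetric e -> connected_graph e ->
  (forall u, K <= #|[set w | dist e u w <= 2]|) ->
  f 0 = v -> (forall a b, a <= b <= R -> dist e (f a) (f b) = b - a) ->
  g 0 = v -> (forall a b, a <= b <= L -> dist e (g a) (g b) = b - a) ->
  (forall a b, a <= R -> h <= b <= L -> 4 < dist e (f a) (g b)) ->
  2 <= h -> 2 <= R -> 5 * p <= R + 3 -> 5 * q + h <= L + 5 ->
  K * (p * (2 * R + 1 - 5 * p) + q * (2 * L + 1 - 5 * q)) <=
  2 * \sum_w dist e v w.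
Proof.
move=> sym con ballK f0 isof g0 isog sep h2 R2 hp hq.
pose c (s : 'I_p + 'I_q) :=
  match s with inl i => f (R - 5 * i) | inr i => g (L - 5 * i) end.
have iso_sep (k n : nat) (F : nat -> T) :
    (forall a b, a <= b <= n -> dist e (F a) (F b) = b - a) ->
    5 * k <= n + 4 -> forall i i' : 'I_k, i != i' ->
    4 < dist e (F (n - 5 * i)) (F (n - 5 * i')).
  move=> iso hk i i' /eqP ne.
  have {}ne : nat_of_ord i <> i' by move/ord_inj.
  have := ltn_ord i; have := ltn_ord i'.
  case: (ltngtP i i') => // ii' ? ?.
  - by rewrite dist_sym // iso; lia.
  - by rewrite iso; lia.
have csep s s' : s != s' -> 4 < dist e (c s) (c s').
  case: s s' => [i|i] [i'|i'] /= ne.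
  - by apply: iso_sep => //; lia.
  - by have := ltn_ord i'; move=> ?; apply: sep; lia.
  - by have := ltn_ord i; move=> ?; rewrite dist_sym //; apply: sep; lia.
  - by apply: iso_sep => //; lia.
have := packing_bound v sym con ballK csep.
rewrite big_sumType /=.
under eq_bigr => i _.
  have -> : dist e v (f (R - 5 * i)) - 2 = R - 2 - 5 * i.
    by rewrite -f0 isof; lia.
  over.
under [X in _ + X]eq_bigr => i _.
  have -> : dist e v (g (L - 5 * i)) - 2 = L - 2 - 5 * i.
    by rewrite -g0 isog; lia.
  over.
move=> main; apply: leq_trans (_ : 2 * (K * _) <= _); last first.
  by rewrite leq_mul2l /=; apply: main.
rewrite mulnCA leq_mul2l; apply/orP; right.
rewrite mulnDr sum_step5; last lia.
rewrite sum_step5; last lia.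
(* When [q] is 0, [L - 2] may be truncated; otherwise [L] is at least 2. *)
have [->|q0] := posnP q; first by rewrite !mul0n !addn0 leq_mul2l; lia.
by apply: leq_add; rewrite leq_mul2l; lia.
Qed.

(** * Choosing the number of centres *)

Lemma one_branch_count (R : nat) : 2 <= R ->
  exists2 p, 5 * p <= R + 3 & R * R + R <= 5 * (p * (2 * R + 1 - 5 * p)) + 6.
Proof.
move=> R2; exists ((R + 3) %/ 5); first lia.
set p := _ %/ 5.
(* With this remainder [k] the loss is exactly 6 - k(5 - k), hence at most 6. *)
have [k [Ek k4]] : exists k, R + 3 = 5 * p + k /\ k <= 4.
  by exists ((R + 3) %% 5); lia.
have [z Ez] : exists z, z = 5 * p by exists (5 * p).
rewrite mulnA -Ez.
have ER : R = z + k - 3 by lia.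
have : (z + k - 3) + 3 = z + k by lia.
rewrite -ER; nia.
Qed.

(** With d = L - 5q the loss is d^2 + d; taking [q] maximal gives d <= h - 1, so 2d <= s + 8. *)
Lemma second_branch_count (L s h : nat) : s + 9 <= 2 * h <= s + 10 -> h <= L + 5 ->
  exists2 q, 5 * q + h <= L + 5 &
    4 * (L * L + L) <= 4 * (5 * (q * (2 * L + 1 - 5 * q))) + (s * s + 18 * s + 80).
Proof.
move=> hs hL; exists ((L + 5 - h) %/ 5); first lia.
set q := _ %/ 5.
have [k [Ek k4]] : exists k, L + 5 = h + 5 * q + k /\ k <= 4.
  by exists ((L + 5 - h) %% 5); lia.
have [z Ez] : exists z, z = 5 * q by exists (5 * q).
rewrite mulnA -Ez; rewrite -Ez in Ek.
have [d Ed] : exists d, L = z + d by exists (L - z); lia.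
have d2 : 2 * d <= s + 8 by lia.
have : 4 * (d * d) + 4 * d <= s * s + 18 * s + 80 by nia.
have -> : 2 * L + 1 - z = z + 2 * d + 1 by lia.
by rewrite Ed; nia.
Qed.

(** * Consequences of minimum degree at least 3 *)

Lemma C4_free_ecc_ge2 (T : finType) (e : rel T) (v : T) :
  simple_graph e -> connected_graph e -> C4_free e -> 3 <= min_degree e ->
  2 <= eccentricity e v.
Proof.
move=> simple con C4 delta3; rewrite leqNgt; apply/negP => ecc1; have [sym _] := simple.
have := C4_free_ball2 v simple con C4.
have := degree_ge e v.
have : #|[set w | dist e v w <= 2]| <= 1 + degree e v.
  apply: leq_trans (_ : #|v |: [set w | e v w]| <= _).
    apply/subset_leq_card/subsetP => w _; rewrite !inE.
    have [//|wv] := eqVneq w v; apply: (dist1_edge con).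
    have := dist_gt0 con wv; have := dist_le_ecc e v w.
    by rewrite (dist_sym w v sym con); lia.
  by rewrite cardsU1 leq_add2r leq_b1.
(* For d the degree of [v], a radius-2 ball of at most 1 + d vertices would force 3d <= 2d. *)
nia.
Qed.

(** The bound is smallest at degree [delta]: m > 0 further neighbours add at least 3m to the product
    and at most m + 1 to the subtracted term. *)
Lemma C4_free_ball2_uniform (T : finType) (e : rel T) (v : T) :
  simple_graph e -> connected_graph e -> C4_free e -> 3 <= min_degree e ->
  (min_degree e * min_degree e).+1 - 2 * (min_degree e %/ 2) <=
  #|[set w | dist e v w <= 2]|.
Proof.
move=> simple con C4 delta3; have := C4_free_ball2 v simple con C4.
have := degree_ge e v; set d := degree e v; set delta := min_degree e.
move=> /subnKC <-; set m := d - delta.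
have : 3 * m <= m * delta by rewrite mulnC leq_mul2l delta3 orbT.
rewrite mulnDl; lia.
Qed.

(** * Bounds on the total distance *)

Lemma sum_dist_ge (T : finType) (e : rel T) (v : T) :
  connected_graph e -> #|T| <= (\sum_w dist e v w).+1.
Proof.
move=> con; rewrite [in leqRHS](bigD1 v) //= distxx -sum1_card (bigD1 v) //= add1n ltnS add0n.
by apply: leq_sum => w wv; rewrite dist_gt0 // eq_sym.
Qed.

Lemma sum_dist_le (T : finType) (e : rel T) (v : T) :
  \sum_w dist e v w <= #|T|.-1 * #|T|.
Proof.
rewrite (bigD1 v) //= distxx add0n -(cardC1 v) -sum_nat_const.
by apply: leq_sum => w _; apply: dist_leq_card.
Qed.

(** Clearing denominators by 40(n - 1) and moving the negative term across keeps the bound on the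
    average distance in [nat]. *)
Lemma C4_free_sum_dist (T : finType) (e : rel T) (v : T) (delta r K : nat) :
  simple_graph e -> connected_graph e -> C4_free e ->
  min_degree e = delta -> 3 <= delta -> radius e = r ->
  K = (delta * delta).+1 - 2 * (delta %/ 2) ->
  K * (8 * (r * r) + 127) <= 40 * (\sum_w dist e v w) + K * (64 * r).
Proof.
move=> simple con C4 Edelta delta3 Er EK; have [sym _] := simple.
have ballK u : K <= #|[set w | dist e u w <= 2]|.
  by rewrite EK -Edelta C4_free_ball2_uniform // Edelta.
have K5 : 5 <= K by rewrite EK; nia.
have KT : K <= #|T| by apply: leq_trans (ballK v) (max_card _).
have sumT := sum_dist_ge v con.
have r2 : 2 <= r.
  rewrite -Er; apply: leq_radius => [|u]; first lia.
  by apply: C4_free_ecc_ge2; rewrite ?Edelta.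
have rR : r <= eccentricity e v by rewrite -Er radius_le.
have [y Ey] := ecc_attained e v; rewrite -Ey in rR.
have [f [f0 fR isof]] := geodesic v y sym con.
move: fR isof rR; set R := dist e v y => fR isof rR.
set S := \sum_w _ in sumT *.
have [p hp cp] : exists2 p, 5 * p <= R + 3 &
  R * R + R <= 5 * (p * (2 * R + 1 - 5 * p)) + 6 by apply: one_branch_count; lia.
(* A packing bound reduces the goal to an inequality free of [K] and [S]. *)
have finish X Y : K * (X + Y) <= 2 * S ->
    8 * (r * r) + 127 <= 4 * (5 * X) + 4 * (5 * Y) + 64 * r ->
    K * (8 * (r * r) + 127) <= 40 * S + K * (64 * r).
  move=> hS hXY; apply: leq_trans (leq_mul (leqnn K) hXY) _.
  rewrite !mulnDr; lia.
(* The one-branch estimate is too weak at r = 2, where the claim is 31K <= 40S; it follows from S >=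
   K - 1 and K >= 5. *)
have [r3|r3] := leqP r 2.
  have -> : r = 2 by lia.
  lia.
have [two|one] := boolP ((14 < r) && (R + 11 <= 2 * r)); last first.
  (* The second branch is void: constant at [v], of length 0 and with no centres. *)
  have isoc a b : a <= b <= 0 -> dist e v v = b - a.
    by case: b => [|b]; rewrite distxx ?sub0n // andbF.
  have sepc a b : a <= R -> 5 <= b <= 0 -> 4 < dist e (f a) v.
    by case: b => [|b] _ /andP[].
  have R2 : 2 <= R by lia.
  have := @two_branch_bound _ _ v K R 0 5 p 0 f (fun=> v) sym con ballK f0 isof
    erefl isoc sepc isT R2 hp isT.
  move/finish; apply; rewrite mul0n muln0 addn0.
  have [z Ez] : exists z, z = 5 * (p * (2 * R + 1 - 5 * p)) by eexists.
  rewrite -Ez in cp *.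
  (* For 3 <= r <= 14 the bound R >= r suffices; beyond that R >= 2r - 10 is used. *)
  have [r14|r14] := leqP r 14.
    have : r * r + r <= R * R + R by nia.
    nia.
  have : (2 * r - 10) * (2 * r - 10) + (2 * r - 10) <= R * R + R by nia.
  nia.
have {two} [r14 uR] := andP two.
(* The shift 9 turns L <= R into s <= 2j - 9, for [s] defined by L + j = r + s. *)
have [j Ej] : exists j, j + r = R + 9 by exists (R + 9 - r); lia.
have [x Ex] := ecc_attained e (f j).
have rx : r <= dist e (f j) x by rewrite Ex -Er radius_le.
have [g [g0 gL isog]] := geodesic v x sym con.
have LR : dist e v x <= R by rewrite /R Ey dist_le_ecc.
move: gL isog LR; set L := dist e v x => gL isog LR.
have levj : dist e v (f j) = j by rewrite -f0 isof; lia.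
have Lj : r <= j + L.
  by have := dist_triangle (f j) v x con; rewrite (dist_sym _ v) // levj; lia.
have [s Es] : exists s, L + j = r + s by exists (L + j - r); lia.
have [h hs] : exists h, s + 9 <= 2 * h <= s + 10 by exists ((s + 10) %/ 2); lia.
have sep a b : a <= R -> h <= b <= L -> 4 < dist e (f a) (g b).
  move=> aR /andP[hb bL]; rewrite ltnNge; apply/negP => close.
  have dvf : dist e v (f a) = a by rewrite -f0 isof; lia.
  have dvg : dist e v (g b) = b by rewrite -g0 isog; lia.
  have t1 := dist_triangle v (f a) (g b) con.
  have t2 := dist_triangle v (g b) (f a) con.
  rewrite (dist_sym (g b)) // in t2.
  have t3 := dist_triangle (f j) (f a) x con.
  have t4 := dist_triangle (f a) (g b) x con.
  have dgx : dist e (g b) x = L - b by rewrite -{1}gL isog; lia.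
  (* As |a - b| <= 4, the detour from [f j] to [x] has length at most r + s + 8 - 2j if j <= a, and
     at most r + s + 8 - 2b otherwise; both are below [r]. *)
  have [ja|aj] := leqP j a.
    have := isof j a; lia.
  have := isof a j; rewrite (dist_sym (f a) (f j)) //; lia.
have hL : h <= L + 5 by lia.
have [q hq cq] := second_branch_count hs hL.
have bound := two_branch_bound sym con ballK f0 isof g0 isog sep.
apply: finish (bound _ _ _ _ hp hq) _; [lia | lia | ].
move: cp cq; move: (5 * (p * _)) (5 * (q * _)) => X Y cp cq.
have [u Eu] : exists u, 2 * r = 9 + R + u by exists (2 * r - 9 - R); lia.
have [w Ew] : exists w, R = u + 9 + w by exists (R - u - 9); lia.
have EL : L = s + u by lia.
(* Since u >= 2, the cross term 8us absorbs the loss linear in [s], leaving s = 0 as the worst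
   case. *)
have u2 : 2 * s <= u * s by rewrite leq_mul2r; lia.
have Er2 : 4 * (r * r) = (18 + 2 * u + w) * (18 + 2 * u + w).
  have -> : 18 + 2 * u + w = 2 * r by lia.
  lia.
rewrite EL in cq; rewrite Ew in cp.
have Y_ge : 4 * (u * u + u) <= 4 * Y + 80 by lia.
(* All terms in [u] cancel; the remaining slack is 2w^2 + 36w + 57. *)
lia.
Qed.

(** * Passage to rational averages *)

Local Open Scope ring_scope.

Theorem theorem5p4 (n delta : nat) (hdelta : (3 <= delta)%N) (hn : (16 <= n)%N)
    (T : finType) (e : rel T) (r : nat)
    (hsimple : simple_graph e)
    (hconn : connected_graph e)
    (hC4 : C4_free e)
    (horder : #|T| = n)
    (hdeg : min_degree e = delta)
    (hrad : radius e = r) :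
  (delta%:R ^+ 2 - 2 * (delta %/ 2)%N%:R + 1) / (5 * (n%:R - 1))
    * (r%:R ^+ 2 - 8 * r%:R + 127 / 8)
  <= proximity e.
Proof.
pose K := ((delta * delta).+1 - 2 * (delta %/ 2))%N.
have EK : delta%:R ^+ 2 - 2 * (delta %/ 2)%N%:R + 1 = K%:R :> rat.
  have : (K + 2 * (delta %/ 2) = delta * delta + 1)%N by rewrite /K; nia.
  by move/(congr1 (fun m => m%:R : rat)); rewrite !natrD !natrM expr2; lra.
have n1 : (0 : rat) < n%:R - 1 by rewrite subr_gt0 ltr1n; lia.
set lhs := _ / _ * _.
have lhs_le v : lhs <= avg_dist e v.
  rewrite /lhs EK /avg_dist horder invfM mulrAC mulrA mulrC ler_wpM2l //.
    by rewrite invr_ge0 ltW.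
  have := C4_free_sum_dist v hsimple hconn hC4 hdeg hdelta hrad (erefl K).
  rewrite -(ler_nat rat) !(natrD, natrM) natr_sum expr2.
  set S := \sum_w _; lra.
have [v _] : exists v : T, v \in T by apply/card_gt0P; rewrite horder; lia.
apply/bigmin_geP; split=> [|w _]; last exact: lhs_le.
(* The default value [#|T|] of the minimum must also be bounded below; it dominates any average
   distance. *)
apply: le_trans (lhs_le v) _; rewrite /avg_dist horder ler_pdivrMl //.
have := sum_dist_le e v; rewrite horder -(ler_nat rat) natr_sum natrM.
by rewrite -subn1 natrB //; lia.
Qed.
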